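(* Let $\phi$ be a second-order sentence over the vocabulary $\{\le\}\cup\{P_i\mid p_i\in\mathrm{AP}\}$. Then there exists a formula $\mathrm{Tr}'(\phi)(R_T)$ of second-order arithmetic ($\Delta^2_0$), with a free 4-ary relation variable $R_T$, such that for all countable trace sets $T$ (with an enumeration $T=(t_i)_{i\in I}$ as below): $$\mathcal M_T\models\phi\iff(\mathbb N,+,\times,\le,0,1)\models\mathrm{Tr}'(\phi)(A_T/R_T).$$
   Context: $\mathrm{AP}=\{p_0,p_1,\dots\}$; a trace is $t\in(2^{\mathrm{AP}})^\omega$, a trace set is a set of traces. $\mathcal M_T$ has domain $T\times\mathbb N$, $(t,n)\le(t',m)$ iff $t=t'$ and $n\le m$, and $P_i=\{(t,j)\mid p_i\in t(j)\}$. $\Delta^2_0$ denotes the set of second-order formulas over $\{+,\times,0,1,=,\le\}$, interpreted in the standard model of arithmetic. A countable trace set is written $T=\{t_i\mid i\in I\}$ with $I=\mathbb N$ or $I=\{0,\dots,n\}$ (distinct indices giving distinct traces). Its encoding $A_T\subseteq\mathbb N^4$ consists of the tuples $(0,i,j,k)$ with $p_k\in t_i(j)$, together with the tuple $(1,n,n,n)$ where $n=|T|$, in case $T$ is finite. *)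

(* Defs.v *)
From mathcomp Require Import all_boot.
From mathcomp Require Import boolp classical_sets functions.
From mathcomp Require Import cardinality.

Set Implicit Arguments.
Unset Strict Implicit.
Unset Printing Implicit Defensive.

Local Open Scope classical_set_scope.

Record signature := Signature {
  fsym : Type;
  far : fsym -> nat;
  rsym : Type;
  rar : rsym -> nat
}.

(* The variable [(k, i)] is the [i]-th relation variable of arity [k]. *)
Definition relvar := (nat * nat)%type.

Definition vararity (X : relvar) : nat := X.1.

Inductive term (L : signature) : Type :=
| Var of nat
| App (f : fsym L) of ('I_(far f) -> term L).

(* Equality is a logical symbol, so it is not listed in signatures. *)
Inductive formula (L : signature) : Type :=
| Eq of term L & term L
| Rel (r : rsym L) of (rar r).-tuple (term L)
| RelVar (X : relvar) of (vararity X).-tuple (term L)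
| Neg of formula L
| And of formula L & formula L
| Or of formula L & formula L
| Ex1 of nat & formula L
| All1 of nat & formula L
| Ex2 of relvar & formula L
| All2 of relvar & formula L.

Fixpoint term_fv L (s : term L) : set nat :=
  match s with
  | Var x => [set x]
  | App f args => [set x | exists i, term_fv (args i) x]
  end.

Definition terms_fv L n (ts : n.-tuple (term L)) : set nat :=
  [set x | exists i, term_fv (tnth ts i) x].

Fixpoint fv1 L (phi : formula L) : set nat :=
  match phi with
  | Eq s u => term_fv s `|` term_fv u
  | Rel _ ts => terms_fv ts
  | RelVar _ ts => terms_fv ts
  | Neg a => fv1 a
  | And a b | Or a b => fv1 a `|` fv1 b
  | Ex1 x a | All1 x a => fv1 a `\ x
  | Ex2 _ a | All2 _ a => fv1 a
  end.

Fixpoint fv2 L (phi : formula L) : set relvar :=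
  match phi with
  | Eq _ _ | Rel _ _ => set0
  | RelVar X _ => [set X]
  | Neg a => fv2 a
  | And a b | Or a b => fv2 a `|` fv2 b
  | Ex1 _ a | All1 _ a => fv2 a
  | Ex2 X a | All2 X a => fv2 a `\ X
  end.

Definition sentence L (phi : formula L) : Prop :=
  fv1 phi = set0 /\ fv2 phi = set0.

Record structure (L : signature) := Structure {
  carrier :> Type;
  finterp : forall f : fsym L, (far f).-tuple carrier -> carrier;
  rinterp : forall r : rsym L, set ((rar r).-tuple carrier)
}.

Arguments finterp {L} s f _.
Arguments rinterp {L} s r _.

Section Semantics.
Variables (L : signature) (M : structure L).

Definition assignment1 := nat -> M.
Definition assignment2 := forall X : relvar, set ((vararity X).-tuple M).

Fixpoint eval (v : assignment1) (s : term L) : M :=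
  match s with
  | Var x => v x
  | App f args => finterp M f [tuple eval v (args i) | i < far f]
  end.

Definition update1 (v : assignment1) (x : nat) (a : M) : assignment1 :=
  @dfwith nat (fun=> M) v x a.

Definition update2 (V : assignment2) (X : relvar)
    (A : set ((vararity X).-tuple M)) : assignment2 :=
  @dfwith relvar (fun Y => set ((vararity Y).-tuple M)) V X A.

Fixpoint sat (v : assignment1) (V : assignment2) (phi : formula L) : Prop :=
  match phi with
  | Eq s u => eval v s = eval v u
  | Rel r ts => rinterp M r (map_tuple (eval v) ts)
  | RelVar X ts => V X (map_tuple (eval v) ts)
  | Neg a => ~ sat v V a
  | And a b => sat v V a /\ sat v V b
  | Or a b => sat v V a \/ sat v V b
  | Ex1 x a => exists m : M, sat (update1 v x m) V a
  | All1 x a => forall m : M, sat (update1 v x m) V a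
  | Ex2 X a =>
      exists A : set ((vararity X).-tuple M), sat v (update2 V A) a
  | All2 X a =>
      forall A : set ((vararity X).-tuple M), sat v (update2 V A) a
  end.

(* For a sentence the assignments are irrelevant, provided [M] is nonempty. *)
Definition models (phi : formula L) : Prop := forall v V, sat v V phi.

(* [M |= phi(A/X)], for [phi] whose only free variable is [X]. *)
Definition models_at (phi : formula L) (X : relvar)
    (A : set ((vararity X).-tuple M)) : Prop :=
  forall v V, sat v (update2 V A) phi.

End Semantics.

Arguments models_at {L} M phi X A.

(* The atomic proposition p_i is represented by [i]; [t j] is the set of
   propositions that hold at position [j]. *)
Definition trace : Type := nat -> set nat.

Inductive trace_rsym := TLe | TP of nat.

Definition trace_sig : signature := {|
  fsym := void;
  far := fun=> 0;
  rsym := trace_rsym;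
  rar := fun r => if r is TP _ then 1 else 2
|}.

Section TraceStructure.
Variable T : set trace.

Definition trace_dom : Type := (T * nat)%type.

Definition trace_rinterp (r : rsym trace_sig) :
    set ((rar r).-tuple trace_dom) :=
  match r with
  | TLe => fun a : 2.-tuple trace_dom =>
      (tnth a ord0).1 = (tnth a ord_max).1 /\
      (tnth a ord0).2 <= (tnth a ord_max).2
  | TP i => fun a : 1.-tuple trace_dom =>
      val (tnth a ord0).1 (tnth a ord0).2 i
  end.

Definition trace_structure : structure trace_sig :=
  @Structure trace_sig trace_dom
    (fun f : void => match f with end) trace_rinterp.

End TraceStructure.

Inductive arith_fsym := AZero | AOne | AAdd | AMul.

Definition arith_sig : signature := {|
  fsym := arith_fsym;
  far := fun f => match f with AZero | AOne => 0 | AAdd | AMul => 2 end;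
  rsym := unit;
  rar := fun=> 2
|}.

Definition arith_finterp (f : fsym arith_sig) :
    (far f).-tuple nat -> nat :=
  match f with
  | AZero => fun=> 0
  | AOne => fun=> 1
  | AAdd => fun a : 2.-tuple nat => tnth a ord0 + tnth a ord_max
  | AMul => fun a : 2.-tuple nat => tnth a ord0 * tnth a ord_max
  end.

Definition arith_structure : structure arith_sig :=
  @Structure arith_sig nat arith_finterp
    (fun=> [set a : 2.-tuple nat | tnth a ord0 <= tnth a ord_max]).

Definition R_T : relvar := (4, 0).

(* [t] enumerates [T] without repetition along [I]; the values of [t] outside
   [I] are irrelevant.  The set [`I_n.+1] is {0, ..., n}. *)
Definition enumerates (T : set trace) (I : set nat) (t : nat -> trace) : Prop :=
  (I = setT \/ exists n, I = `I_n.+1) /\ set_bij I T t.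

Local Open Scope card_scope.

Definition encoding (T : set trace) (I : set nat) (t : nat -> trace) :
    set (4.-tuple nat) :=
  [set a | (exists i j k, [/\ I i, t i j k & a = [tuple 0; i; j; k]]) \/
           (exists2 n, T #= `I_n & a = [tuple 1; n; n; n])].

(* Main.v *)
Require Import Defs.
From mathcomp Require Import all_boot.
From mathcomp Require Import boolp functions cardinality.
From mathcomp Require Import classical_sets.

(** The position [(t_i, j)] is represented by the pair [(i, j)], so that each
    first-order variable becomes two number variables and each [k]-ary relation
    variable becomes a [2k]-ary one.  First-order quantifiers are relativized
    to [i \in I], which is definable from the tuple [(1, n, n, n)] of the
    encoding.  Second-order quantifiers need no relativization: the translated
    relations are only ever evaluated at codes of positions. *)

Set Implicit Arguments.
Unset Strict Implicit.
Unset Printing Implicit Defensive.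

Local Open Scope classical_set_scope.

(** * Translation of trace formulas into arithmetic *)

Local Notation tterm := (term trace_sig).
Local Notation aterm := (term arith_sig).
Local Notation aformula := (formula arith_sig).

Definition zero_tm : aterm := @App arith_sig AZero (fun i : 'I_0 => Var _ i).
Definition one_tm : aterm :=
  @App arith_sig AOne (fun i : 'I_0 => Var _ i).
Definition add_tm (a b : aterm) : aterm :=
  @App arith_sig AAdd (tnth [tuple a; b]).
Definition numeral (k : nat) : aterm := iter k (add_tm one_tm) zero_tm.

Definition le_fm (a b : aterm) : aformula := @Rel arith_sig tt [tuple a; b].
Definition RT_fm (a b c d : aterm) : aformula :=
  RelVar (X := R_T) [tuple a; b; c; d].

(* Expresses [y \in I]: a tuple [(1, n, n, n)] is encoded only when [T] is
   finite, and then [I = {0, ..., n - 1}]. *)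
Definition index_fm (y : nat) : aformula :=
  All1 y.+1 (Or (Neg (RT_fm one_tm (Var _ y.+1) (Var _ y.+1) (Var _ y.+1)))
                (Neg (le_fm (Var _ y.+1) (Var _ y)))).

(** Even variables hold trace indices and odd ones times, so distinct [x] get disjoint pairs of
    number variables. *)
Definition trace_tm (s : tterm) : aterm :=
  match s with Var x => Var _ x.*2 | App f _ => match f : void with end end.
Definition time_tm (s : tterm) : aterm :=
  match s with Var x => Var _ x.*2.+1 | App f _ => match f : void with end end.

(** Doubling the arity alone would send [(2, 0)] to [R_T]; the shifted index avoids this clash. *)
Definition relvar_tr (X : relvar) : relvar := (X.1 + X.1, X.2.+1).

Definition rel_tr (r : rsym trace_sig) : (rar r).-tuple tterm -> aformula :=
  match r with
  | TLe => fun ts : 2.-tuple tterm =>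
      And (Eq (trace_tm (tnth ts ord0)) (trace_tm (tnth ts ord_max)))
          (le_fm (time_tm (tnth ts ord0)) (time_tm (tnth ts ord_max)))
  | TP i => fun ts : 1.-tuple tterm =>
      RT_fm zero_tm (trace_tm (tnth ts ord0)) (time_tm (tnth ts ord0))
            (numeral i)
  end.

Fixpoint tr (phi : formula trace_sig) : aformula :=
  match phi with
  | Eq s u => And (Eq (trace_tm s) (trace_tm u)) (Eq (time_tm s) (time_tm u))
  | Rel r ts => rel_tr ts
  | RelVar X ts =>
      RelVar (X := relvar_tr X)
        (cat_tuple (map_tuple trace_tm ts) (map_tuple time_tm ts))
  | Neg a => Neg (tr a)
  | And a b => And (tr a) (tr b)
  | Or a b => Or (tr a) (tr b)
  | Ex1 x a => Ex1 x.*2 (Ex1 x.*2.+1 (And (index_fm x.*2) (tr a)))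
  | All1 x a => All1 x.*2 (All1 x.*2.+1 (Or (Neg (index_fm x.*2)) (tr a)))
  | Ex2 X a => Ex2 (relvar_tr X) (tr a)
  | All2 X a => All2 (relvar_tr X) (tr a)
  end.

(** * Free variables of the translation and values of its auxiliary terms *)

Lemma relvar_tr_inj : injective relvar_tr.
Proof.
by move=> [k i] [l j] [] /eqP; rewrite !addnn => /eqP /double_inj -> ->.
Qed.

Lemma relvar_tr_neqRT X : relvar_tr X != R_T.
Proof. by case: X => k i; rewrite xpair_eqE andbF. Qed.

(** The fold computes on explicit tuples and splits over concatenations. *)
Lemma terms_fvE L n (ts : n.-tuple (term L)) :
  terms_fv ts = foldr (fun s A => term_fv s `|` A) set0 ts.
Proof.
elim: n ts => [|n IH] ts.
  by rewrite tuple0; apply/seteqP; split=> // x [[]].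
case/tupleP: ts => s ts /=; rewrite -IH; apply/seteqP; split=> x.
  case=> i; case: (unliftP ord0 i) => [j|] ->; last by rewrite tnth0; left.
  by rewrite tnthS; right; exists j.
case=> [sx|[j jx]]; first by exists ord0; rewrite tnth0.
by exists (lift ord0 j); rewrite tnthS.
Qed.

Lemma zero_tm_fv : term_fv zero_tm = set0.
Proof. by apply/seteqP; split=> // x [[]]. Qed.

Lemma one_tm_fv : term_fv one_tm = set0.
Proof. by apply/seteqP; split=> // x [[]]. Qed.

Lemma add_tm_fv a b : term_fv (add_tm a b) = term_fv a `|` term_fv b.
Proof. by rewrite -[LHS]/(terms_fv [tuple a; b]) terms_fvE /= setU0. Qed.

Lemma numeral_fv k : term_fv (numeral k) = set0.
Proof.
elim: k => [|k IH]; first exact: zero_tm_fv.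
rewrite -[numeral _]/(add_tm one_tm (numeral k)).
by rewrite add_tm_fv IH one_tm_fv setU0.
Qed.

Lemma eval_numeral (w : nat -> nat) k :
  @eval arith_sig arith_structure w (numeral k) = k.
Proof.
elim: k => // k IH.
by rewrite -[numeral _]/(add_tm one_tm (numeral k)) /= !tnth_mktuple IH.
Qed.

Lemma eval_zero (w : nat -> nat) :
  @eval arith_sig arith_structure w zero_tm = 0.
Proof. by []. Qed.

Lemma eval_one (w : nat -> nat) :
  @eval arith_sig arith_structure w one_tm = 1.
Proof. by []. Qed.

Local Opaque zero_tm one_tm numeral.

Lemma trace_tm_fv s x : term_fv (trace_tm s) x -> term_fv s x./2.
Proof. by case: s => [y|[]] /= ->; rewrite doubleK. Qed.

Lemma time_tm_fv s x : term_fv (time_tm s) x -> term_fv s x./2.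
Proof. by case: s => [y|[]] /= ->; rewrite /= uphalf_double. Qed.

Lemma foldr_fv_map L L' (f : term L -> term L') (g : nat -> nat)
    (ts : seq (term L)) x :
  (forall s, term_fv (f s) x -> term_fv s (g x)) ->
  foldr (fun s A => term_fv s `|` A) set0 (map f ts) x ->
  foldr (fun s A => term_fv s `|` A) set0 ts (g x).
Proof. by move=> h; elim: ts => //= s ts IH [/h|/IH]; [left|right]. Qed.

(** In [tr], [y] is [x.*2], so the bound variable [y.+1] coincides with the time variable of [x];
    this reuse is harmless because only [y] is free. *)
Lemma index_fm_fv1 y : fv1 (index_fm y) = [set y].
Proof.
rewrite /index_fm /= !terms_fvE /= one_tm_fv; apply/seteqP; split=> x /=.
  by rewrite /setD/=; tauto.
move=> ->; split; first tauto.
by move=> /eqP; rewrite -{1}(addn0 y) -addn1 eqn_add2l.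
Qed.

Lemma index_fm_fv2 y : fv2 (index_fm y) = [set R_T].
Proof. by rewrite /index_fm /= setU0. Qed.

Lemma sat_index_fm (w : assignment1 arith_structure)
    (W : assignment2 arith_structure) y :
  @sat _ arith_structure w W (index_fm y) <->
  forall n, W R_T [tuple 1; n; n; n] -> w y < n.
Proof.
have eq4 n : map_tuple (@eval _ arith_structure (update1 w y.+1 n))
    [tuple one_tm; Var _ y.+1; Var _ y.+1; Var _ y.+1] = [tuple 1; n; n; n].
  by apply/val_inj; rewrite /= eval_one /update1 dfwith_in.
have eq2 n : map_tuple (@eval _ arith_structure (update1 w y.+1 n))
    [tuple Var _ y.+1; Var _ y] = [tuple n; w y].
  apply/val_inj; rewrite /= /update1 dfwith_in dfwith_out //.
  by rewrite gtn_eqF.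
rewrite /index_fm /=; split=> h n; have := h n; rewrite eq4 eq2 /= ltnNge.
  by move=> {}h Wn; apply/negP; case: h.
move=> {}h; have [/h/negP|] := EM (W R_T [tuple 1; n; n; n]); last by left.
by right.
Qed.

Local Opaque index_fm.

Lemma neq_half x y : x <> y.*2 -> x <> y.*2.+1 -> x./2 <> y.
Proof.
by move=> h0 h1 e; move: h0 h1; rewrite -e -{1 3}(odd_double_half x); case: odd.
Qed.

(** Halving sends both variables made from [y] back to [y]. A translated quantifier binds both, so
    whatever stays free halves to something other than [y]. *)
Lemma fv1_tr phi x : fv1 (tr phi) x -> fv1 phi x./2.
Proof.
elim: phi x => [s u|r ts|X ts|a IH|a IHa b IHb|a IHa b IHb|y a IH|y a IH|
    X a IH|X a IH] x; rewrite ?[tr _]/=.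
- by case=> [[/trace_tm_fv|/trace_tm_fv]|[/time_tm_fv|/time_tm_fv]];
    solve [by left | by right].
- case: r ts => [|i] ts.
    rewrite /= [terms_fv [tuple _; _]]terms_fvE /=.
    by case=> [[/trace_tm_fv|/trace_tm_fv]|[/time_tm_fv|[/time_tm_fv|//]]] h;
      solve [by exists (ord0 : 'I_2) | by exists (ord_max : 'I_2)].
  rewrite /= [terms_fv [tuple _; _; _; _]]terms_fvE /=.
  rewrite zero_tm_fv numeral_fv.
  by case=> [//|[/trace_tm_fv|[/time_tm_fv|[]//]]] h; exists ord0.
- rewrite /= !terms_fvE /= foldr_cat => h.
  have {h} : foldr (fun s A => term_fv s `|` A) set0 (map trace_tm ts) x \/
             foldr (fun s A => term_fv s `|` A) set0 (map time_tm ts) x.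
    elim: (map trace_tm ts) h => [|s l IH] /=; first by right.
    by case=> [sx|/IH]; tauto.
  case; apply: (@foldr_fv_map trace_sig arith_sig) => s.
    exact: trace_tm_fv.
  exact: time_tm_fv.
- exact: IH.
- by case=> [/IHa|/IHb]; [left|right].
- by case=> [/IHa|/IHb]; [left|right].
- rewrite [fv1 (Ex1 _ _)]/= index_fm_fv1.
  by case=> -[[//|/IH ax] n1] n0; split=> //; apply: neq_half.
- rewrite [fv1 (All1 _ _)]/= index_fm_fv1.
  by case=> -[[//|/IH ax] n1] n0; split=> //; apply: neq_half.
- exact: IH.
- exact: IH.
Qed.

(** [R_T] enters through the index guards and the atoms [TP i]; all other relation variables are
    images under [relvar_tr]. *)
Lemma fv2_tr phi X :
  fv2 (tr phi) X -> X = R_T \/ exists2 Y, fv2 phi Y & X = relvar_tr Y.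
Proof.
elim: phi X => [s u|r ts|Z ts|a IH|a IHa b IHb|a IHa b IHb|y a IH|y a IH|
    Z a IH|Z a IH] X; rewrite ?[tr _]/=.
- by case.
- by case: r ts => [|i] ts /=; [case=> // -[]|left].
- by move=> ->; right; exists Z.
- exact: IH.
- by case=> [/IHa|/IHb] [|[Y hY ->]]; try (by left); right; exists Y;
    by [left|right|].
- by case=> [/IHa|/IHb] [|[Y hY ->]]; try (by left); right; exists Y;
    by [left|right|].
- by rewrite [fv2 (Ex1 _ _)]/= index_fm_fv2 => -[|/IH]; first by left.
- by rewrite [fv2 (All1 _ _)]/= index_fm_fv2 => -[|/IH]; first by left.
- case=> /IH[->|[Y hY ->] n]; first by left.
  by right; exists Y => //; split=> // e; apply: n; rewrite e.
- case=> /IH[->|[Y hY ->] n]; first by left.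
  by right; exists Y => //; split=> // e; apply: n; rewrite e.
Qed.

(** * Coding tuples of pairs as tuples of numbers *)

Definition flatten_pairs k (p : k.-tuple (nat * nat)) : (k + k).-tuple nat :=
  cat_tuple (map_tuple fst p) (map_tuple snd p).

(** Both halves have length [k], so the concatenation splits uniquely and zipping recovers the
    pairs. *)
Lemma flatten_pairs_inj k : injective (@flatten_pairs k).
Proof.
move=> p q /(congr1 val) /= /eqP.
rewrite eqseq_cat ?size_map ?size_tuple // => /andP[/eqP h1 /eqP h2].
apply/val_inj => /=.
by rewrite -[LHS]zip_unzip -[RHS]zip_unzip /unzip1 /unzip2 h1 h2.
Qed.

Lemma map_tuple_inj A B (f : A -> B) k :
  injective f -> injective (@map_tuple k A B f).
Proof. by move=> fi p q /(congr1 val) /= /(inj_map fi) /val_inj. Qed.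

(** * Correctness of the translation for a fixed enumeration *)

Section Correctness.
Variables (T : set trace) (I : set nat) (t : nat -> trace).
Hypothesis TIt : enumerates T I t.
Variable idx : T -> nat.
Hypothesis idxI : forall s, I (idx s).
Hypothesis idxK : forall s, t (idx s) = val s.

Let M := trace_structure T.
Let N := arith_structure.
Let E := encoding T I t.

Definition code (d : M) : nat * nat := (idx d.1, d.2).

Lemma idx_inj : injective idx.
Proof. by move=> a b e; apply/val_inj; rewrite -!idxK e. Qed.

Lemma code_inj : injective code.
Proof. by move=> [a i] [b j] [/idx_inj -> ->]. Qed.

(** Injectivity of [t] on [I] forces the index that [idx] chooses for the trace [t i] to be [i]
    itself. *)
Lemma code_surj i j : I i -> exists d, code d = (i, j).
Proof.
move=> Ii; case: TIt => _ [fI tinj _].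
have Tti : t i \in T by rewrite inE; apply: fI.
exists (exist _ (t i) Tti, j); congr pair.
by apply: tinj; rewrite ?inE // idxK.
Qed.

Lemma encoding_trace i j k : E [tuple 0; i; j; k] <-> I i /\ t i j k.
Proof.
split=> [[[i' [j' [k' [Ii tijk]]]]|[n _ /(congr1 val)] //]|[Ii tijk]].
  by move=> /(congr1 val) [-> -> ->].
by left; exists i, j, k.
Qed.

Lemma encoding_card n : E [tuple 1; n; n; n] <-> (T #= `I_n)%card.
Proof.
split=> [[[i' [j' [k' [_ _ /(congr1 val)]]]] //|]|Tn]; last by right; exists n.
by move=> [m Tm /(congr1 val) [->]].
Qed.

(** [T] has the cardinality of [I]. If [I] is [setT], no tuple [(1, n, n, n)] occurs and the
    condition is vacuous; if [I] is an initial segment, its size is the only such [n]. *)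
Lemma index_encoding i : I i <-> forall n, E [tuple 1; n; n; n] -> i < n.
Proof.
case: TIt => IE tb.
have TI : (T #= I)%card.
  by have [f _] := Pbij tb; apply/card_esym/(pcard_eq f).
split=> [Ii n /encoding_card|h].
  rewrite (card_eql TI); case: IE Ii => [->|[m ->]] Ii.
    by move=> Nn; case: infinite_nat; exists n.
  by move/card_eq_II => <-.
case: IE TI h => [->//|[n ->]] TI h.
by apply: h; apply/encoding_card.
Qed.

Lemma sat_index (w : assignment1 N) (W : assignment2 N) y :
  W R_T = E -> sat w W (index_fm y) <-> I (w y).
Proof. by move=> WE; rewrite sat_index_fm WE index_encoding. Qed.

(** [P] will be the set of free variables: a binder then asks nothing of the old value of its
    variable, and for a sentence any two assignments are related. *)
Definition sim1 (P : set nat) (v : assignment1 M) (w : assignment1 N) : Prop :=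
  forall x, P x -> code (v x) = (w x.*2, w x.*2.+1).

Definition sim2 (P : set relvar) (V : assignment2 M) (W : assignment2 N) :
    Prop :=
  forall X, P X -> forall a,
    V X a <-> W (relvar_tr X) (flatten_pairs (map_tuple code a)).

(** Parity separates index variables from time variables, and injectivity of doubling separates
    different [x]. *)
Lemma sim1_update P v w x d :
  sim1 (P `\ x) v w ->
  sim1 P (update1 v x d)
    (update1 (update1 w x.*2 (code d).1) x.*2.+1 (code d).2).
Proof.
move=> sim y Py; rewrite /update1.
have [->|nyx] := eqVneq x y.
  by rewrite !dfwith_in dfwith_out ?gtn_eqF // dfwith_in.
rewrite !dfwith_out ?eqSS ?(inj_eq double_inj) //.
- by apply: sim; split=> // /esym/eqP; apply/negP.
- by apply/eqP => /(congr1 odd); rewrite /= !odd_double.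
- by apply/eqP => /(congr1 odd); rewrite /= !odd_double.
Qed.

Lemma sim2_update P V W X A B :
  (forall a, A a <-> B (flatten_pairs (map_tuple code a))) ->
  sim2 (P `\ X) V W ->
  sim2 P (update2 V A) (update2 (X := relvar_tr X) W B).
Proof.
move=> AB sim Y PY; rewrite /update2.
have [<-|nYX] := eqVneq X Y; first by rewrite !dfwith_in.
rewrite !dfwith_out ?(inj_eq relvar_tr_inj) //.
by apply: sim; split=> // /esym/eqP; apply/negP.
Qed.

(** Second-order quantifiers preserve the invariant that [R_T] denotes the encoding. *)
Lemma update2_RT (W : assignment2 N) X B :
  W R_T = E -> @update2 _ N W (relvar_tr X) B R_T = E.
Proof. by move=> <-; rewrite /update2 dfwith_out // relvar_tr_neqRT. Qed.

Definition code_set k (A : set (k.-tuple M)) : set ((k + k).-tuple nat) :=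
  (fun a => flatten_pairs (map_tuple code a)) @` A.

Lemma code_setP k (A : set (k.-tuple M)) a :
  A a <-> code_set A (flatten_pairs (map_tuple code a)).
Proof.
split=> [Aa|[b Ab /flatten_pairs_inj /(map_tuple_inj code_inj) <- //]].
by exists a.
Qed.

Lemma sim1_eval P v w s :
  sim1 P v w -> term_fv s `<=` P ->
  code (@eval _ M v s) = (@eval _ N w (trace_tm s), @eval _ N w (time_tm s)).
Proof. by case: s => [x|[]] sim /(_ x erefl) /sim. Qed.

Lemma sim1_sub P Q v w : Q `<=` P -> sim1 P v w -> sim1 Q v w.
Proof. by move=> QP sim x /QP /sim. Qed.

Lemma sim2_sub P Q V W : Q `<=` P -> sim2 P V W -> sim2 Q V W.
Proof. by move=> QP sim x /QP /sim. Qed.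

(** Induction on [phi] for all assignments at once. The update lemmas restore similarity under a
    binder, and [code] ranges exactly over the pairs that the index guard admits. *)
Lemma sat_tr phi (v : assignment1 M) (V : assignment2 M)
    (w : assignment1 N) (W : assignment2 N) :
  W R_T = E -> sim1 (fv1 phi) v w -> sim2 (fv2 phi) V W ->
  sat v V phi <-> sat w W (tr phi).
Proof.
elim: phi v V w W => [s u|r ts|X ts|a IH|a IHa b IHb|a IHa b IHb|x a IH|x a IH|
    X a IH|X a IH] v V w W WE s1 s2; rewrite ?[tr _]/=.
- have := sim1_eval s1 (@subsetUl _ _ _).
  have := sim1_eval s1 (@subsetUr _ _ _).
  move=> [eu1 eu2] [es1 es2] /=; rewrite -eu1 -eu2 -es1 -es2.
  split=> [->//|[/idx_inj e1 e2]].
  by move: e1 e2; case: (eval v s) => ? ?; case: (eval v u) => ? ? /= -> ->.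
- have ev i : code (eval v (tnth ts i)) =
      (@eval _ N w (trace_tm (tnth ts i)), @eval _ N w (time_tm (tnth ts i))).
    by apply: sim1_eval s1 _ => x h; exists i.
  case: r ts {s1 s2} ev => [|i] ts ev.
    have [e1 e2] := ev ord0; have [e3 e4] := ev ord_max.
    rewrite /= !tnth_map /tnth /= -e1 -e2 -e3 -e4.
    (* Equal indices mean equal traces, by injectivity of [idx]. *)
    by split=> -[]; [move=> -> | move=> /idx_inj].
  have [e1 e2] := ev ord0.
  set d := eval v (tnth ts ord0) in e1 e2 *.
  have -> : sat w W (rel_tr ts) = W R_T [tuple 0; (code d).1; (code d).2; i].
    rewrite /=; congr (W _ _); apply/val_inj.
    by rewrite /= eval_zero eval_numeral e1 e2.
  (* Codes have their index in [I], so only the clause [t i j k] of the encoding carries content. *)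
  rewrite WE encoding_trace /= !tnth_map idxK.
  by split=> [//|[]].
- suff E' : @map_tuple _ _ _ (@eval _ N w)
      (cat_tuple (map_tuple trace_tm ts) (map_tuple time_tm ts)) =
      flatten_pairs (map_tuple code (map_tuple (@eval _ M v) ts)).
    by rewrite /= E'; exact: s2.
  have ec i : code (eval v (tnth ts i)) =
      (@eval _ N w (trace_tm (tnth ts i)), @eval _ N w (time_tm (tnth ts i))).
    by apply: sim1_eval s1 _ => x h; exists i.
  have e1 : map_tuple (@eval _ N w) (map_tuple trace_tm ts) =
      map_tuple fst (map_tuple code (map_tuple (@eval _ M v) ts)).
    by apply: eq_from_tnth => i; rewrite !tnth_map ec.
  have e2 : map_tuple (@eval _ N w) (map_tuple time_tm ts) =
      map_tuple snd (map_tuple code (map_tuple (@eval _ M v) ts)).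
    by apply: eq_from_tnth => i; rewrite !tnth_map ec.
  apply/val_inj; rewrite /= map_cat.
  by move: e1 e2 => /(congr1 val) /= -> /(congr1 val) /= ->.
- by rewrite /= (IH v V w W).
- have ha := IHa v V w W WE (sim1_sub (@subsetUl _ _ _) s1)
                            (sim2_sub (@subsetUl _ _ _) s2).
  have hb := IHb v V w W WE (sim1_sub (@subsetUr _ _ _) s1)
                            (sim2_sub (@subsetUr _ _ _) s2).
  by rewrite /= ha hb.
- have ha := IHa v V w W WE (sim1_sub (@subsetUl _ _ _) s1)
                            (sim2_sub (@subsetUl _ _ _) s2).
  have hb := IHb v V w W WE (sim1_sub (@subsetUr _ _ _) s1)
                            (sim2_sub (@subsetUr _ _ _) s2).
  by rewrite /= ha hb.
- have IHd d := IH _ V _ W WE (@sim1_update _ v w x d s1) s2.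
  split=> [[d da]|[i [j []]]].
    exists (code d).1, (code d).2; split; last exact/IHd.
    apply/sat_index; rewrite // /update1 dfwith_out ?gtn_eqF // dfwith_in.
    exact: idxI.
  (* The guard on [i] makes [(i, j)] the code of a position, which is the witness. *)
  move/(sat_index _ _ WE); rewrite /update1 dfwith_out ?gtn_eqF // dfwith_in.
  move=> /(code_surj j) [d cd] da; exists d.
  by apply/IHd; rewrite cd.
- have IHd d := IH _ V _ W WE (@sim1_update _ v w x d s1) s2.
  split=> [h i j|h d].
    set w' := update1 _ _ _.
    have [/(sat_index _ _ WE)|] := EM (sat w' W (index_fm x.*2)); last by left.
    rewrite /w' /update1 dfwith_out ?gtn_eqF // dfwith_in.
    move=> /(code_surj j) [d cd]; right.
    by have /IHd := h d; rewrite cd.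
  case: (h (code d).1 (code d).2) => [[]|/IHd//].
  apply/sat_index; rewrite // /update1 dfwith_out ?gtn_eqF // dfwith_in.
  exact: idxI.
- have IHB A B AB := IH _ _ w _ (@update2_RT W X B WE) s1
                        (@sim2_update _ V W X A B AB s2).
  split=> [[A hA]|[B hB]].
    (* A relation on positions is matched by its image, exactly because the coding is injective; a
       relation on numbers is matched by its preimage. *)
    by exists (code_set A); apply: (IHB A _ (code_setP A)).1 hA.
  exists [set b | B (flatten_pairs (map_tuple code b))].
  by apply: (IHB _ B _).2 hB.
- have IHB A B AB := IH _ _ w _ (@update2_RT W X B WE) s1
                        (@sim2_update _ V W X A B AB s2).
  split=> [h B|h A].
    by apply: (IHB _ B _).1 (h [set b | B (flatten_pairs (map_tuple code b))]).
  by apply: (IHB A _ (code_setP A)).2 (h (code_set A)).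
Qed.

End Correctness.

Theorem theorem5 (phi : formula trace_sig) (hphi : sentence phi) :
  exists psi : formula arith_sig,
    [/\ fv1 psi = set0,
        fv2 psi = [set R_T]%classic &
        forall (T : set trace) (I : set nat) (t : nat -> trace),
          enumerates T I t ->
          models (trace_structure T) phi <->
          models_at arith_structure psi R_T (encoding T I t)].
Proof.
case: hphi => phi1 phi2.
(* The vacuous outer quantifier makes [R_T] occur even if [tr phi] has no
   atom mentioning it. *)
exists (Ex1 0 (And (index_fm 0) (tr phi))); split.
- rewrite /= index_fm_fv1; apply/seteqP; split=> // x [[//|/fv1_tr]].
  by rewrite phi1.
- rewrite /= index_fm_fv2; apply/seteqP; split=> X; last by left.
  by case=> [//|/fv2_tr [//|[Y]]]; rewrite phi2.
move=> T I t TIt; have [IE [fI tinj tsurj]] := TIt.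
(* Both admissible shapes of [I] contain [0]; hence [T] is nonempty, and [0] can witness the vacuous
   quantifier. *)
have I0 : I 0 by case: IE => [->|[n ->]].
have /choice [idx idxP] (s : T) : exists i, I i /\ t i = val s.
  by have := set_valP s => /tsurj [i Ii <-]; exists i.
have tr_ok v V w (W : assignment2 arith_structure) : W R_T = encoding T I t ->
    @sat _ (trace_structure T) v V phi <-> @sat _ arith_structure w W (tr phi).
  (* Without free variables both similarities hold vacuously. *)
  move=> WE; apply: (sat_tr TIt (fun s => (idxP s).1) (fun s => (idxP s).2) WE).
    by rewrite phi1.
  by rewrite phi2.
split=> [h w W|h v V].
  have W'E : @update2 _ arith_structure W R_T (encoding T I t) R_T =
      encoding T I t.
    exact: dfwith_in.
  have Tt0 : t 0 \in T by rewrite inE; apply: fI.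
  exists 0; split.
    by apply/(sat_index TIt _ _ W'E); rewrite /update1 dfwith_in.
  (* [models] quantifies over assignments, so using it takes at least one. *)
  pose v0 : nat -> T * nat := fun=> (exist _ (t 0) Tt0, 0).
  by apply: (tr_ok v0 (fun=> set0) _ _ W'E).1; exact: h.
(* Any starting assignments do, as [models_at] resets the value at [R_T]. *)
have [i [_]] := h (fun=> 0) (fun=> set0).
by move/tr_ok; apply; exact: dfwith_in.
Qed.
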